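(* Let $M={}_{f_2}M_1\times_{f_1}M_2$ be a pseudo-Riemannian doubly warped product with metric $g=f_2^2g_1+f_1^2g_2$, and let $\zeta=\zeta_1+\zeta_2$ be a vector field on $M$ with $\zeta_i\in\mathfrak X(M_i)$. Assume that $\zeta_i$ is a Killing vector field on $(M_i,g_i)$ for each $i=1,2$ and that $\zeta_1(\ln f_1)=\zeta_2(\ln f_2)$ on $M$. Then $\zeta$ is a conformal vector field on $(M,g)$.
   Context: $(M_1,g_1)$ and $(M_2,g_2)$ are pseudo-Riemannian manifolds and $f_i:M_i\to(0,\infty)$ are smooth functions. The doubly warped product is $M_1\times M_2$ with metric $g=(f_2\circ\pi_2)^2\pi_1^*g_1+(f_1\circ\pi_1)^2\pi_2^*g_2$, where $\pi_i$ is the projection onto $M_i$; functions on $M_i$ are identified with their pullbacks, and vector fields on $M_i$ with their lifts to $M$. A vector field $\zeta$ on $(N,h)$ is conformal with conformal factor $\rho\in C^\infty(N)$ if $\mathcal L_\zeta h=\rho h$, and Killing if $\rho=0$. *)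

(* Defs.v *)
From HB Require Import structures.
From mathcomp Require Import all_boot all_order all_algebra.
From mathcomp Require Import all_classical all_reals.
From mathcomp Require Import topology normedtype derive landau.
Set Implicit Arguments.
Unset Strict Implicit.
Unset Printing Implicit Defensive.
Import Order.TTheory GRing.Theory Num.Theory.
Import numFieldNormedType.Exports.
Local Open Scope classical_set_scope.
Local Open Scope ring_scope.

Section SmoothMaps.
Context {R : realType} {V W : normedModType R}.

(* Between finite-dimensional spaces this is the usual C^k: differentiability
   in the sense of Frechet, with C^(k-1) derivatives in every fixed direction.
   It is only meant for open U. *)
Fixpoint Ck (k : nat) (U : set V) (f : V -> W) : Prop :=
  if k is k'.+1 then
    (forall x, U x -> differentiable f x) /\
    (forall v, Ck k' U (fun x => 'D_v f x))
  else forall x, U x -> {for x, continuous f}.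

Definition smooth_on (U : set V) (f : V -> W) : Prop := forall k, Ck k U f.

End SmoothMaps.

Section CkTheory.
Context {R : realType}.
Implicit Types V W : normedModType R.

Lemma derive_affine V V' W (A : {linear V' -> V}) (b : V) (f : V -> W)
  (v x : V') : 'D_v (fun x => f (A x + b)) x = 'D_(A v) f (A x + b).
Proof.
rewrite /derive; set g := (X in lim (X @ _)); set h := (X in _ = lim (X @ _)).
suff -> : g = h by [].
by apply/funext => t; rewrite /g /h /= linearP addrA.
Qed.

Lemma Ck_precomp V V' W k (A : {linear V' -> V}) (b : V) (U : set V)
    (f : V -> W) : continuous A -> Ck k U f ->
  Ck k [set x | U (A x + b)] (fun x => f (A x + b)).
Proof.
move=> cA; elim: k f => [|k IH] f.
  move=> cf x /= Ux; apply: (@continuous_comp _ _ _ (fun x => A x + b) f).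
    by apply: continuousD; [exact: cA|exact: cst_continuous].
  exact: cf.
move=> [df Df]; split=> [x /= Ux|v].
  apply: (@differentiable_comp _ _ _ _ (fun x => A x + b) f); last exact: df.
  by apply: differentiableD; [exact: linear_differentiable|exact: differentiable_cst].
have -> : (fun x => 'D_v (fun x => f (A x + b)) x) =
    (fun x => 'D_(A v) f (A x + b)); last exact: (IH _ (Df (A v))).
by apply/funext => x; exact: derive_affine.
Qed.

Lemma near_eq_differentiable V W (f g : V -> W) (x : V) :
  {near x, f =1 g} -> differentiable f x -> differentiable g x.
Proof.
move=> fg df; rewrite (_ : g = f + (g - f)); last first.
  by apply/funext => y; rewrite !fctE addrC subrK.
apply: differentiableD => //.
set e := g - f; have e0 : \forall y \near x, e y = 0.
  by near=> y; rewrite /e !fctE (near fg y)// subrr.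
have de : e \o shift x = cst (e x) + (\0 : {linear V -> W}) +o_ 0 id.
  apply/eqaddoP => eps eps0.
  have : \forall y \near (0 : V), e (y + x) = 0 by rewrite (near_shift x)/=;
    near=> y; rewrite /= sub0r addrNK; near: y.
  apply: filterS => y ey; rewrite !fctE /= ey (nbhs_singleton e0).
  by rewrite addr0 subrr normr0 mulr_ge0// ltW.
have c0 : continuous (\0 : V -> W) by move=> y; exact: cvg_cst.
by apply/diff_locallyP; rewrite (diff_unique c0 de).
Unshelve. all: by end_near. Qed.

Lemma eq_Ck V W k (U : set V) (f g : V -> W) :
  open U -> (forall x, U x -> f x = g x) -> Ck k U f -> Ck k U g.
Proof.
move=> oU; elim: k f g => [|k IH] f g fg.
  move=> cf x Ux; rewrite /prop_for /continuous_at -fg//.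
  apply: cvg_trans (cf x Ux); apply: near_eq_cvg.
  by near=> y; apply: fg; near: y; exact: open_nbhs_nbhs.
have nfg x : U x -> {near x, f =1 g}.
  by move=> Ux; near=> y; apply: fg; near: y; exact: open_nbhs_nbhs.
move=> [df Df]; split=> [x Ux|v].
  by apply: near_eq_differentiable (nfg _ Ux) _; exact: df.
apply: IH (Df v) => x Ux; apply: near_eq_derive; exact: nfg.
Unshelve. all: by end_near. Qed.

Lemma CkD V W k (U : set V) (f g : V -> W) :
  open U -> Ck k U f -> Ck k U g -> Ck k U (f \+ g).
Proof.
move=> oU; elim: k f g => [|k IH] f g.
  by move=> cf cg x Ux; apply: continuousD; [exact: cf|exact: cg].
move=> [df Df] [dg Dg]; split=> [x Ux|v].
  by apply: differentiableD; [exact: df|exact: dg].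
apply: eq_Ck oU _ (IH _ _ (Df v) (Dg v)) => x Ux /=.
by rewrite deriveD//; apply: diff_derivable; [exact: df|exact: dg].
Qed.

Lemma Ck_postcomp V W W' k (A : {linear W -> W'}) (U : set V) (f : V -> W) :
  open U -> continuous A -> Ck k U f -> Ck k U (A \o f).
Proof.
move=> oU cA; elim: k f => [|k IH] f.
  by move=> cf x Ux; apply: continuous_comp; [exact: cf|exact: cA].
move=> [df Df]; split=> [x Ux|v].
  apply: differentiable_comp; first exact: df.
  exact: linear_differentiable.
apply: eq_Ck oU _ (IH _ (Df v)) => x Ux /=.
have dfx := df x Ux; have dA := linear_differentiable (f x) cA.
rewrite deriveE//= (deriveE v (differentiable_comp dfx dA)).
by rewrite (diff_comp dfx dA)/= (diff_lin (f x) cA).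
Qed.

End CkTheory.

Section RowVectors.
Context {R : realType}.

Lemma cvg_rV (T : topologicalType) n (g : T -> 'rV[R]_n) (p : T) :
  (forall j, {for p, continuous (fun q => g q 0 j)}) -> {for p, continuous g}.
Proof.
move=> cg A /= [P PA sPA]; apply: filterS; first exact: sPA.
have h i j : \forall q \near p, P i j (g q i j).
  by rewrite ord1; apply: (cg j); rewrite -(ord1 i); exact: PA.
near=> q => /= i j; move: i j; near: q.
by apply: filter_forall => i; apply: filter_forall => j; exact: h.
Unshelve. all: by end_near. Qed.

Definition rV_inl n1 n2 (x : 'rV[R]_n1) : 'rV[R]_(n1 + n2) := row_mx x 0.
Definition rV_inr n1 n2 (x : 'rV[R]_n2) : 'rV[R]_(n1 + n2) := row_mx 0 x.

Fact rV_inl_linear n1 n2 : linear (@rV_inl n1 n2).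
Proof. by move=> a u v; rewrite /rV_inl scale_row_mx add_row_mx scaler0 addr0. Qed.
Fact rV_inr_linear n1 n2 : linear (@rV_inr n1 n2).
Proof. by move=> a u v; rewrite /rV_inr scale_row_mx add_row_mx scaler0 addr0. Qed.
HB.instance Definition _ n1 n2 :=
  GRing.isLinear.Build R 'rV[R]_n1 'rV[R]_(n1 + n2) _ (@rV_inl n1 n2)
    (@rV_inl_linear n1 n2).
HB.instance Definition _ n1 n2 :=
  GRing.isLinear.Build R 'rV[R]_n2 'rV[R]_(n1 + n2) _ (@rV_inr n1 n2)
    (@rV_inr_linear n1 n2).

Lemma rV_inlr n1 n2 (x : 'rV[R]_n1) (y : 'rV[R]_n2) :
  row_mx x y = rV_inl n2 x + rV_inr n1 y.
Proof. by rewrite /rV_inl /rV_inr add_row_mx addr0 add0r. Qed.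

Lemma continuous_row_mx (T : topologicalType) n1 n2 (g : T -> 'rV[R]_n1)
    (h : T -> 'rV[R]_n2) (p : T) :
  {for p, continuous g} -> {for p, continuous h} ->
  {for p, continuous (fun q => row_mx (g q) (h q))}.
Proof.
move=> cg ch; apply: cvg_rV => j; case: (split_ordP j) => k ->.
  rewrite (_ : (fun q => _) = (fun q => g q 0 k)).
    exact: (continuous_comp cg (@coord_continuous _ _ _ 0 k (g p))).
  by apply/funext => q; rewrite row_mxEl.
rewrite (_ : (fun q => _) = (fun q => h q 0 k)).
  exact: (continuous_comp ch (@coord_continuous _ _ _ 0 k (h p))).
by apply/funext => q; rewrite row_mxEr.
Qed.

Lemma rV_inl_continuous n1 n2 : continuous (@rV_inl n1 n2).
Proof.
move=> x; apply: (@continuous_row_mx _ _ _ id (cst 0)); first exact: cvg_id.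
exact: cst_continuous.
Qed.
Lemma rV_inr_continuous n1 n2 : continuous (@rV_inr n1 n2).
Proof.
move=> x; apply: (@continuous_row_mx _ _ _ (cst 0) id); last exact: cvg_id.
exact: cst_continuous.
Qed.

Lemma lsubmx_continuous n1 n2 :
  continuous (@lsubmx R 1 n1 n2).
Proof.
move=> x; apply: cvg_rV => j.
rewrite (_ : (fun q => _) = (fun q : 'rV[R]_(n1 + n2) => q 0 (lshift n2 j))).
  exact: coord_continuous.
by apply/funext => q; rewrite mxE.
Qed.
Lemma rsubmx_continuous n1 n2 :
  continuous (@rsubmx R 1 n1 n2).
Proof.
move=> x; apply: cvg_rV => j.
rewrite (_ : (fun q => _) = (fun q : 'rV[R]_(n1 + n2) => q 0 (rshift n1 j))).
  exact: coord_continuous.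
by apply/funext => q; rewrite mxE.
Qed.

End RowVectors.

(* A Hausdorff second countable space with a smooth n-dimensional atlas.  The
   charts cmap i : cdom i -> cran i and their inverses cinv i are given as total
   functions whose values outside cdom i, resp. cran i, are irrelevant.  Neither
   connectedness nor 0 < n is required. *)
Record manifold (R : realType) (n : nat) := Manifold {
  point :> topologicalType;
  chart : Type;
  cdom : chart -> set point;
  cran : chart -> set 'rV[R]_n;
  cmap : chart -> point -> 'rV[R]_n;
  cinv : chart -> 'rV[R]_n -> point;
  mfd_hausdorff : hausdorff_space point;
  mfd_second_countable : @second_countable point;
  cdom_open : forall i, open (cdom i);
  cran_open : forall i, open (cran i);
  cmap_ran : forall i p, cdom i p -> cran i (cmap i p);
  cinv_dom : forall i x, cran i x -> cdom i (cinv i x);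
  cmapK : forall i p, cdom i p -> cinv i (cmap i p) = p;
  cinvK : forall i x, cran i x -> cmap i (cinv i x) = x;
  cmap_continuous : forall i p, cdom i p -> {for p, continuous (cmap i)};
  cinv_continuous : forall i x, cran i x -> {for x, continuous (cinv i)};
  chart_cover : forall p, exists i, cdom i p;
  chart_transition : forall i j,
    smooth_on [set x | cran i x /\ cdom j (cinv i x)] (cmap j \o cinv i)
}.

Section TopologicalProducts.

Lemma hausdorff_prod (T U : topologicalType) :
  hausdorff_space T -> hausdorff_space U -> hausdorff_space (T * U)%type.
Proof.
move=> hT hU [t u] [t' u'] clx; congr (_, _).
- apply: hT => A B At Bt; have [||[a b] [/= Aa Ba]] := clx (fst @^-1` A) (fst @^-1` B).
  + exact: (@cvg_fst _ _ (nbhs t) (nbhs u)).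
  + exact: (@cvg_fst _ _ (nbhs t') (nbhs u')).
  + by exists a.
- apply: hU => A B At Bt; have [||[a b] [/= Aa Ba]] := clx (snd @^-1` A) (snd @^-1` B).
  + exact: (@cvg_snd _ _ (nbhs t) (nbhs u)).
  + exact: (@cvg_snd _ _ (nbhs t') (nbhs u')).
  + by exists b.
Qed.

Lemma openX (T U : topologicalType) (A : set T) (B : set U) :
  open A -> open B -> open (A `*` B).
Proof.
move=> oA oB; rewrite openE => -[t u] [/= At Bu].
by exists (A, B) => //; split; exact: open_nbhs_nbhs.
Qed.

Lemma second_countable_prod (T U : topologicalType) :
  @second_countable T -> @second_countable U ->
  @second_countable (T * U)%type.
Proof.
move=> [BT cT [oT bT]] [BU cU [oU bU]].
exists ((fun AB : set T * set U => AB.1 `*` AB.2) @` (BT `*` BU)).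
  exact/(card_le_trans (card_image_le _ _))/countableX.
split=> [_ [[A B] [/= TA UB] <-]|[t u] W [[A B] [/= At Bu] sW]].
  by apply: openX; [exact: oT|exact: oU].
have [A' [TA' A't] sA] := bT _ _ At; have [B' [UB' B'u] sB] := bU _ _ Bu.
exists (A' `*` B'); first by split=> //; exists (A', B').
by move=> [a b] [/= A'a B'b]; apply: sW; split; [exact: sA|exact: sB].
Qed.

End TopologicalProducts.

Lemma sub_Ck (R : realType) (V W : normedModType R) k (U U' : set V)
  (f : V -> W) : U' `<=` U -> Ck k U f -> Ck k U' f.
Proof.
move=> sU; elim: k f => [|k IH] f /=; first by move=> cf x /sU; exact: cf.
by move=> [df Df]; split=> [x /sU /df//|v]; exact: IH.
Qed.

Lemma open_chart (R : realType) n (M : manifold R n) (i : chart M) (W : set M) :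
  open W -> open [set x | cran i x /\ W (cinv i x)].
Proof.
move=> oW; rewrite openE => x [ix Wx]; apply: filterI.
  by apply: open_nbhs_nbhs; split=> //; exact: cran_open.
by apply: (cinv_continuous ix); exact: open_nbhs_nbhs.
Qed.

Section ProductManifold.
Context {R : realType} {n1 n2 : nat} (M1 : manifold R n1) (M2 : manifold R n2).

Definition prod_map (ij : chart M1 * chart M2) (x : M1 * M2) :
  'rV[R]_(n1 + n2) := row_mx (cmap ij.1 x.1) (cmap ij.2 x.2).
Definition prod_inv (ij : chart M1 * chart M2) (u : 'rV[R]_(n1 + n2)) :
  M1 * M2 := (cinv ij.1 (lsubmx u), cinv ij.2 (rsubmx u)).
Definition prod_dom (ij : chart M1 * chart M2) : set (M1 * M2) :=
  [set x | cdom ij.1 x.1 /\ cdom ij.2 x.2].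
Definition prod_ran (ij : chart M1 * chart M2) : set 'rV[R]_(n1 + n2) :=
  [set u | cran ij.1 (lsubmx u) /\ cran ij.2 (rsubmx u)].

Fact prod_dom_open ij : open (prod_dom ij).
Proof. by apply: openX; exact: cdom_open. Qed.

Fact prod_ran_open ij : open (prod_ran ij).
Proof.
rewrite openE => u [u1 u2]; apply: filterI.
- apply: lsubmx_continuous; apply: open_nbhs_nbhs; split=> //; exact: cran_open.
- apply: rsubmx_continuous; apply: open_nbhs_nbhs; split=> //; exact: cran_open.
Qed.

Fact prod_map_ran ij x : prod_dom ij x -> prod_ran ij (prod_map ij x).
Proof.
by move=> [x1 x2]; rewrite /prod_ran /prod_map /= row_mxKl row_mxKr; split;
  exact: cmap_ran.
Qed.

Fact prod_inv_dom ij u : prod_ran ij u -> prod_dom ij (prod_inv ij u).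
Proof. by move=> [u1 u2]; split; exact: cinv_dom. Qed.

Fact prod_mapK ij x : prod_dom ij x -> prod_inv ij (prod_map ij x) = x.
Proof.
case: x => p q [/= x1 x2]; rewrite /prod_inv /prod_map /=.
by rewrite row_mxKl row_mxKr !cmapK.
Qed.

Fact prod_invK ij u : prod_ran ij u -> prod_map ij (prod_inv ij u) = u.
Proof. by move=> [u1 u2]; rewrite /prod_map /= !cinvK// hsubmxK. Qed.

Fact prod_map_continuous ij x :
  prod_dom ij x -> {for x, continuous (prod_map ij)}.
Proof.
case: x => p q [/= x1 x2]; apply: continuous_row_mx.
- by apply: (@continuous_comp _ _ _ fst); [exact: cvg_fst|exact: cmap_continuous].
- by apply: (@continuous_comp _ _ _ snd); [exact: cvg_snd|exact: cmap_continuous].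
Qed.

Fact prod_inv_continuous ij u :
  prod_ran ij u -> {for u, continuous (prod_inv ij)}.
Proof.
move=> [u1 u2]; apply: cvg_pair; first exact: (@nbhs_filter _ u).
- have c := @lsubmx_continuous R n1 n2 u.
  exact: (continuous_comp c (cinv_continuous u1)).
- have c := @rsubmx_continuous R n1 n2 u.
  exact: (continuous_comp c (cinv_continuous u2)).
Qed.

Fact prod_cover (x : M1 * M2) : exists ij, prod_dom ij x.
Proof.
have [i x1] := chart_cover x.1; have [j x2] := chart_cover x.2.
by exists (i, j).
Qed.

Fact prod_transition ij kl :
  smooth_on [set u | prod_ran ij u /\ prod_dom kl (prod_inv ij u)]
    (prod_map kl \o prod_inv ij).
Proof.
move=> k; set U := [set u | _].
have oU : open U.
  rewrite openE => u [iju klu]; apply: filterI.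
    by apply: open_nbhs_nbhs; split=> //; exact: prod_ran_open.
  by apply: (prod_inv_continuous iju); apply: open_nbhs_nbhs; split=> //;
    exact: prod_dom_open.
pose t1 := cmap kl.1 \o cinv ij.1; pose t2 := cmap kl.2 \o cinv ij.2.
have E : (prod_map kl \o prod_inv ij) =
    (rV_inl n2 \o (fun u => t1 (lsubmx u + 0))) \+
    (@rV_inr R n1 n2 \o (fun u => t2 (rsubmx u + 0))).
  by apply/funext => u /=; rewrite !addr0 -rV_inlr.
rewrite E; apply: CkD => //; apply: Ck_postcomp => //.
- exact: rV_inl_continuous.
- apply: sub_Ck (Ck_precomp 0 (@lsubmx_continuous _ _ _)
    (@chart_transition _ _ _ ij.1 kl.1 k)).
  by move=> u [[u1 u2] [v1 v2]] /=; rewrite addr0.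
- exact: rV_inr_continuous.
- apply: sub_Ck (Ck_precomp 0 (@rsubmx_continuous _ _ _)
    (@chart_transition _ _ _ ij.2 kl.2 k)).
  by move=> u [[u1 u2] [v1 v2]] /=; rewrite addr0.
Qed.

Definition prod_manifold : manifold R (n1 + n2) :=
  Manifold (hausdorff_prod (@mfd_hausdorff _ _ M1) (@mfd_hausdorff _ _ M2))
    (second_countable_prod (@mfd_second_countable _ _ M1)
      (@mfd_second_countable _ _ M2))
    prod_dom_open prod_ran_open prod_map_ran prod_inv_dom prod_mapK prod_invK
    prod_map_continuous prod_inv_continuous prod_cover prod_transition.

End ProductManifold.

Section Schwarz.
Context {R : realType} {V : normedModType R}.
Implicit Types (F : V -> R) (x u v : V).

Lemma is_derive_line F x u (s : R) : differentiable F (x + s *: u) ->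
  is_derive s 1 (fun s : R => F (x + s *: u)) ('D_u F (x + s *: u)).
Proof.
move=> dF; pose l : R^o -> V := ( *:%R^~ u) + cst x.
have dl : differentiable l s by apply: differentiableD => //; exact: ex_diff.
have le r : x + r *: u = l r by rewrite /l !fctE addrC.
have -> : (fun s : R => F (x + s *: u)) = F \o l.
  by apply/funext => r /=; rewrite le.
rewrite le in dF *.
have dFl : differentiable (F \o l) s by exact: differentiable_comp.
apply: DeriveDef; first exact/diff_derivable.
rewrite deriveE// diff_comp//= deriveE//; congr ('d F _ _).
by rewrite diffD//= diff_cst/= addr0 diff_val scale1r.
Qed.

Lemma MVT_line F x u (t : R) : 0 < t ->
  (forall s, 0 <= s <= t -> differentiable F (x + s *: u)) ->
  exists2 s, 0 <= s <= t & F (x + t *: u) - F x = t * 'D_u F (x + s *: u).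
Proof.
move=> t0 dF.
have [||s + E] := @MVT R (fun s => F (x + s *: u))
    (fun s => 'D_u F (x + s *: u)) 0 t t0.
- move=> s; rewrite in_itv/= => /andP[s0 st]; apply: is_derive_line.
  by apply: dF; rewrite !ltW.
- apply: derivable_within_continuous => s; rewrite in_itv/= => st.
  by have [] := is_derive_line (dF _ st).
- rewrite in_itv/= => /andP[s0 st]; exists s; first by rewrite !ltW.
  by move: E; rewrite scale0r addr0 subr0 mulrC.
Qed.

Lemma mixed_difference (G : set V) F x u v (t : R) : 0 < t ->
  (forall s r, 0 <= s <= t -> 0 <= r <= t -> G (x + s *: u + r *: v)) ->
  (forall y, G y -> differentiable F y) ->
  (forall y, G y -> differentiable (fun z => 'D_u F z) y) ->
  exists2 y, G y &
    F (x + t *: u + t *: v) - F (x + t *: u) - (F (x + t *: v) - F x) =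
    t * (t * 'D_v (fun z => 'D_u F z) y).
Proof.
move=> t0 Gx dF dDF.
have tt : 0 <= t <= t by rewrite lexx ltW.
have t00 : 0 <= (0 : R) <= t by rewrite lexx ltW.
pose H := (fun y => F (y + t *: v)) - F.
have dFv s : 0 <= s <= t -> differentiable (fun y => F (y + t *: v)) (x + s *: u).
  move=> st; apply: (@differentiable_comp _ _ _ _ (fun y => y + t *: v) F).
    have -> : (fun y => y + t *: v) = id + cst (t *: v) by [].
    exact: differentiableD.
  by apply: dF; exact: Gx.
have dF0 s : 0 <= s <= t -> differentiable F (x + s *: u).
  by move=> st; apply: dF; have := Gx s 0 st t00; rewrite scale0r addr0.
have [s st E] : exists2 s, 0 <= s <= t &
    H (x + t *: u) - H x = t * 'D_u H (x + s *: u).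
  by apply: MVT_line => // s st; apply: differentiableB; [exact: dFv|exact: dF0].
have [r rt E'] : exists2 r, 0 <= r <= t &
    'D_u F (x + s *: u + t *: v) - 'D_u F (x + s *: u) =
    t * 'D_v (fun z => 'D_u F z) (x + s *: u + r *: v).
  apply: (@MVT_line (fun z => 'D_u F z) (x + s *: u) v t t0) => r rt.
  by apply: dDF; exact: Gx.
exists (x + s *: u + r *: v); first exact: Gx.
rewrite -E' -[LHS]/(H (x + t *: u) - H x) E /H; congr (t * _); rewrite deriveB.
- by rewrite (derive_affine (idfun : {linear V -> V})).
- by apply: diff_derivable; exact: dFv.
- by apply: diff_derivable; exact: dF0.
Qed.

Lemma dist_half (a b m e : R) :
  `|a - m| < e / 2 -> `|b - m| < e / 2 -> `|a - b| <= e.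
Proof.
move=> h1 h2; rewrite -(subrKA m) (le_trans (ler_normD _ _))//.
by rewrite [leRHS](splitr e) lerD ?ltW// distrC.
Qed.

Lemma schwarz (U : set V) F x u v : open U -> smooth_on U F -> U x ->
  'D_v (fun z => 'D_u F z) x = 'D_u (fun z => 'D_v F z) x.
Proof.
move=> oU sF Ux.
have [dF DF] := sF 2%N.
have dDF w y : U y -> differentiable (fun z => 'D_w F z) y.
  by have [+ _] := DF w; exact.
have cDF w w' : {for x, continuous (fun z => 'D_w' (fun z => 'D_w F z) z)}.
  by have [_ /(_ w')] := DF w; exact.
apply/eqP; rewrite -subr_eq0 -normr_eq0 eq_le normr_ge0 andbT.
apply/ler_addgt0Pl => e e0; rewrite addr0.
have e20 : 0 < e / 2 by rewrite divr_gt0.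
pose G := [set y | U y /\
  (`|'D_v (fun z => 'D_u F z) x - 'D_v (fun z => 'D_u F z) y| < e / 2 /\
   `|'D_u (fun z => 'D_v F z) x - 'D_u (fun z => 'D_v F z) y| < e / 2)].
have : nbhs x G.
  apply: filterI; first exact: open_nbhs_nbhs.
  apply: filterI.
  - by have /cvgrPdist_lt /(_ _ e20) := cDF u v.
  - by have /cvgrPdist_lt /(_ _ e20) := cDF v u.
move=> /nbhs_ballP[d /= d0 xG].
pose t := d / (`|u| + `|v| + 1).
have N0 : 0 < `|u| + `|v| + 1 by rewrite ltr_wpDl// addr_ge0.
have t0 : 0 < t by rewrite divr_gt0.
have Gst s r : 0 <= s <= t -> 0 <= r <= t -> G (x + s *: u + r *: v).
  move=> /andP[s0 st] /andP[r0 rt]; apply: xG.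
  rewrite -ball_normE /= -addrA opprD addNKr normrN.
  apply: (@le_lt_trans _ _ (t * (`|u| + `|v|))).
    rewrite mulrDr; apply: (le_trans (ler_normD _ _)).
    by rewrite !normrZ !ger0_norm// lerD// ler_wpM2r.
  by rewrite /t mulrAC ltr_pdivrMr// ltr_pM2l// ltrDl.
have [y1 [Uy1 [h1 _]] E1] : exists2 y, G y & _ :=
  @mixed_difference G F x u v t t0 Gst (fun y Gy => dF y Gy.1)
    (fun y Gy => dDF u y Gy.1).
have Gst' s r : 0 <= s <= t -> 0 <= r <= t -> G (x + s *: v + r *: u).
  by move=> st rt; rewrite addrAC; exact: Gst.
have [y2 [Uy2 [_ h2]] E2] : exists2 y, G y & _ :=
  @mixed_difference G F x v u t t0 Gst' (fun y Gy => dF y Gy.1)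
    (fun y Gy => dDF v y Gy.1).
have E : 'D_v (fun z => 'D_u F z) y1 = 'D_u (fun z => 'D_v F z) y2.
  apply: (mulfI (lt0r_neq0 t0)); apply: (mulfI (lt0r_neq0 t0)).
  apply: etrans (esym E1) _; apply: etrans _ E2; rewrite (addrAC x (t *: v)).
  move: (F _) (F (x + t *: u)) (F (x + t *: v)) (F x) => a b c d'.
  by rewrite !opprB addrACA [RHS]addrACA (addrC (- b)).
by rewrite -E in h2; exact: dist_half h1 h2.
Qed.

End Schwarz.

Section Tangent.
Context {R : realType} {n : nat} {M : manifold R n}.

Definition msmooth_on (W : set M) (f : M -> R) : Prop :=
  forall i : chart M, smooth_on [set x | cran i x /\ W (cinv i x)] (f \o cinv i).

Definition msmooth_near (p : M) (f : M -> R) : Prop :=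
  exists2 W, open_nbhs p W & msmooth_on W f.

Lemma msmooth_near_diff (p : M) (f : M -> R) (i : chart M) :
  cdom i p -> msmooth_near p f -> differentiable (f \o cinv i) (cmap i p).
Proof.
move=> ip [W [oW Wp] sf]; have [df _] := sf i 1%N; apply: df => /=.
by rewrite cmapK//; split=> //; exact: cmap_ran.
Qed.

(* T_p M as the space of operators f |-> sum_k u_k (d f / d x^k)(p).  Operators
   act on all functions M -> R, so their value is normalized to 0 on those which
   are not smooth near p; this makes the operator representing a tangent vector
   unique. *)
Definition is_tangent (p : M) (D : (M -> R) -> R) : Prop :=
  (forall i : chart M, cdom i p -> exists u : 'rV[R]_n,
     forall f, msmooth_near p f -> D f = 'D_u (f \o cinv i) (cmap i p)) /\
  (forall f, ~ msmooth_near p f -> D f = 0).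

Definition tangent_pred (p : M) : {pred (M -> R) -> R} :=
  fun D => `[< is_tangent p D >].

Fact tangent_submod (p : M) : submod_closed (tangent_pred p).
Proof.
split; first by apply/asboolP; split=> // i ip; exists 0 => f _; rewrite derive0.
move=> a D1 D2 /asboolP[t1 z1] /asboolP[t2 z2]; apply/asboolP; split.
  move=> i ip; have [u1 E1] := t1 i ip; have [u2 E2] := t2 i ip.
  exists (a *: u1 + u2) => f sf; have df := msmooth_near_diff ip sf.
  rewrite deriveE// linearP -!deriveE// -E1// -E2//.
by move=> f nf; rewrite !fctE z1// z2// scaler0 addr0.
Qed.

HB.instance Definition _ (p : M) :=
  GRing.isSubmodClosed.Build _ _ (tangent_pred p) (tangent_submod p).

Record tangent (p : M) := Tangent {
  tangent_fun :> (M -> R) -> R;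
  _ : tangent_fun \in tangent_pred p }.

HB.instance Definition _ (p : M) := [isSub for @tangent_fun p].
HB.instance Definition _ (p : M) := [Choice of tangent p by <:].
HB.instance Definition _ (p : M) :=
  [SubChoice_isSubLmodule of tangent p by <:].

(* The tangent vector f |-> D f, f smooth near p.  It is used only for operators D
   which are tangent vectors, in which case its value on f is D f: see
   to_tangentE, and its instances bracketE, pushforward_fstE, pushforward_sndE,
   lift1E and lift2E. *)
Definition to_tangent (p : M) (D : (M -> R) -> R) : tangent p :=
  insubd 0 (fun f => if `[< msmooth_near p f >] then D f else 0).

(* Not necessarily smooth; a smooth field on an open W is given by any extension
   to M. *)
Definition vfield := forall p : M, tangent p.

Definition vfield_smooth_on (W : set M) (X : vfield) : Prop :=
  forall W' f, open W' -> W' `<=` W -> msmooth_on W' f ->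
    msmooth_on W' (fun p => X p f).

Definition bracket (X Y : vfield) : vfield := fun p =>
  to_tangent p (fun f => X p (fun q => Y q f) - Y p (fun q => X q f)).

Definition form2 := forall p : M, tangent p -> tangent p -> R.

(* Linearity in the second argument only, the other one follows by symmetry.  The
   last clause says that the components of g in every chart are smooth, since X
   and Y may be coordinate fields. *)
Definition pseudo_riemannian (g : form2) : Prop :=
  [/\ (forall p v, linear (g p v : _ -> R^o)),
      (forall p v w, g p v w = g p w v),
      (forall p v, (forall w, g p v w = 0) -> v = 0) &
      (forall W X Y, open W -> vfield_smooth_on W X -> vfield_smooth_on W Y ->
         msmooth_on W (fun p => g p (X p) (Y p)))].

(* (L_Z h)(X, Y) = Z (h (X, Y)) - h ([Z, X], Y) - h (X, [Z, Y]) *)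
Definition lie_form2 (Z : vfield) (h : form2) (X Y : vfield) (p : M) : R :=
  Z p (fun q => h q (X q) (Y q)) - h p (bracket Z X p) (Y p)
    - h p (X p) (bracket Z Y p).

(* L_Z h = rho h.  As L_Z h is a tensor field, hence local, it is evaluated on
   fields which are smooth on an arbitrary open set; extending these by cutoff
   functions shows that testing on global fields amounts to the same. *)
Definition conformal_with (h : form2) (Z : vfield) (rho : M -> R) : Prop :=
  [/\ vfield_smooth_on setT Z, msmooth_on setT rho &
      forall W X Y, open W -> vfield_smooth_on W X -> vfield_smooth_on W Y ->
        forall p, W p -> lie_form2 Z h X Y p = rho p * h p (X p) (Y p)].

Definition conformal (h : form2) (Z : vfield) : Prop :=
  exists rho, conformal_with h Z rho.

Definition killing (h : form2) (Z : vfield) : Prop :=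
  conformal_with h Z (fun=> 0).

End Tangent.

Arguments tangent {R n} M p.
Arguments vfield {R n} M.
Arguments form2 {R n} M.

Definition pushforward {R : realType} {m n : nat} {M : manifold R m}
    {N : manifold R n} (F : M -> N) (p : M) (v : tangent M p) :
  tangent N (F p) := to_tangent (F p) (fun f => v (f \o F)).

Section ToTangent.
Context {R : realType} {n : nat} {M : manifold R n}.

Lemma tangentP (p : M) (v : tangent M p) : is_tangent p v.
Proof. by case: v => D /= /asboolP. Qed.

Lemma to_tangentE (p : M) (D : (M -> R) -> R) (f : M -> R) :
  (forall i : chart M, cdom i p -> exists u : 'rV[R]_n,
     forall f, msmooth_near p f -> D f = 'D_u (f \o cinv i) (cmap i p)) ->
  msmooth_near p f -> to_tangent p D f = D f.
Proof.
move=> tD sf; rewrite /to_tangent -[tangent_fun _]/(val _) insubdK.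
  by case: asboolP.
apply/asboolP; split=> [i ip|h nh]; last by case: asboolP.
have [u E] := tD i ip; exists u => h sh; case: asboolP => // _; exact: E.
Qed.

End ToTangent.

Section Bracket.
Context {R : realType} {n : nat} {M : manifold R n}.

Lemma derive_row (F : 'rV[R]_n -> R) (x : 'rV[R]_n) (c : 'I_n -> R) :
  differentiable F x ->
  'D_(\row_k c k) F x = \sum_k c k * 'D_(delta_mx 0 k) F x.
Proof.
move=> dF; rewrite deriveE// (row_sum_delta (\row_k c k)) linear_sum.
by apply: eq_bigr => k _; rewrite linearZ mxE deriveE.
Qed.

Definition rV_coord (k : 'I_n) (v : 'rV[R]_n) : R^o := v 0 k.
Fact rV_coord_linear k : linear (rV_coord k).
Proof. by move=> a u v; rewrite /rV_coord !mxE. Qed.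
HB.instance Definition _ k :=
  GRing.isLinear.Build R 'rV[R]_n R^o _ (rV_coord k) (rV_coord_linear k).

Lemma rV_coord_continuous k : continuous (rV_coord k).
Proof. by move=> x; exact: coord_continuous. Qed.

Lemma msmooth_coord (i : chart M) k :
  msmooth_on (cdom i) (fun q : M => rV_coord k (cmap i q)).
Proof.
move=> j m; apply: Ck_postcomp (chart_transition j i m).
  exact/open_chart/cdom_open.
exact: rV_coord_continuous.
Qed.

Lemma sub_msmooth (W W' : set M) f :
  W' `<=` W -> msmooth_on W f -> msmooth_on W' f.
Proof. by move=> sW sf i k; apply: sub_Ck (sf i k) => x [? /sW]. Qed.

Definition component (p : M) (v : tangent M p) (i : chart M) : 'rV[R]_n :=
  \row_k v (fun q => rV_coord k (cmap i q)).

Lemma tangent_chartE (p : M) (v : tangent M p) (i : chart M) (f : M -> R) :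
  cdom i p -> msmooth_near p f ->
  v f = 'D_(component v i) (f \o cinv i) (cmap i p).
Proof.
move=> ip sf; have [t _] := tangentP v; have [u E] := t i ip.
rewrite E//; congr ('D_ _ _ _); apply/rowP => k; rewrite mxE E; last first.
  by exists (cdom i); [split=> //; exact: cdom_open|exact: msmooth_coord].
have -> : u 0 k = 'D_u (rV_coord k) (cmap i p).
  rewrite deriveE ?diff_lin//; [exact: rV_coord_continuous|].
  exact/linear_differentiable/rV_coord_continuous.
apply: near_eq_derive; have ir := cmap_ran ip.
near=> x; rewrite /= cinvK//; near: x.
by apply: open_nbhs_nbhs; split=> //; exact: cran_open.
Unshelve. all: by end_near. Qed.

Lemma iterated_derivation (W : set M) (X Y : vfield M) (p : M) (i : chart M)
    (f : M -> R) : open W -> W p -> cdom i p -> vfield_smooth_on W Y ->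
  msmooth_near p f ->
  X p (fun q => Y q f) =
  'D_(component (Y p) i) (fun x => 'D_(component (X p) i) (f \o cinv i) x) (cmap i p)
  + 'D_(\row_k 'D_(component (X p) i)
          (fun x => component (Y (cinv i x)) i 0 k) (cmap i p))
      (f \o cinv i) (cmap i p).
Proof.
move=> oW Wp ip sY [W' [oW' W'p] sf].
pose N := W `&` W' `&` cdom i.
have oN : open N by do 2?apply: openI => //; exact: cdom_open.
have Np : N p by [].
pose F := f \o cinv i; pose O := [set x | cran i x /\ N (cinv i x)].
have oO : open O by exact: open_chart.
have Ox : O (cmap i p) by split; [exact: cmap_ran|rewrite cmapK].
have sF : smooth_on O F.
  by apply: (@sub_msmooth _ N _ _ sf i) => q [[]].
have dF x : O x -> differentiable F x by have [+ _] := sF 1%N; exact.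
have dDF v x : O x -> differentiable (fun y => 'D_v F y) x.
  by have [_ /(_ v) [+ _]] := sF 2%N; exact.
pose b k x := component (Y (cinv i x)) i 0 k.
have sb k : smooth_on O (b k).
  have : msmooth_on N (fun q => Y q (fun q => rV_coord k (cmap i q))).
    apply: sY => //; first by move=> q [[]].
    by apply: sub_msmooth (msmooth_coord i k) => q [].
  move=> /(_ i) h m; apply: eq_Ck oO _ (h m) => x _.
  by rewrite /b /component mxE.
have db k x : O x -> differentiable (b k) x by have [+ _] := sb k 1%N; exact.
have YfE x : O x -> Y (cinv i x) f = \sum_k b k x * 'D_(delta_mx 0 k) F x.
  move=> [ix [[Wx W'x] dx]]; rewrite (tangent_chartE _ dx); last by exists W'.
  rewrite cinvK// -derive_row; last by apply: dF.
  by congr ('D_ _ _ _); apply/rowP => k; rewrite [RHS]mxE.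
rewrite (tangent_chartE _ ip); last first.
  exists N => //; apply: sY => //; first by move=> q [[]].
  by apply: sub_msmooth sf => q [[]].
set a := component (X p) i.
have -> : 'D_a ((fun q => Y q f) \o cinv i) (cmap i p) =
    'D_a (\sum_(k < n) (b k * (fun x => 'D_(delta_mx 0 k) F x))) (cmap i p).
  apply: near_eq_derive; near=> x; rewrite /= YfE.
    by rewrite fct_sumE.
  by near: x; exact: open_nbhs_nbhs.
rewrite derive_sum; last first.
  by move=> k; apply: derivableM; apply: diff_derivable; [exact: db|exact: dDF].
have -> : component (Y p) i = \row_k b k (cmap i p).
  by apply/rowP => k; rewrite [RHS]mxE /b cmapK.
rewrite !derive_row; [|exact: dF|exact: dDF].
rewrite -big_split; apply: eq_bigr => k _ /=.
rewrite deriveM; [|apply: diff_derivable; exact: db|apply: diff_derivable; exact: dDF].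
by rewrite (schwarz _ _ oO sF Ox) [_ *: 'D_a (b k) _]mulrC.
Unshelve. all: by end_near. Qed.

Lemma bracketE (W : set M) (X Y : vfield M) (p : M) (f : M -> R) :
  open W -> W p -> vfield_smooth_on W X -> vfield_smooth_on W Y ->
  msmooth_near p f ->
  bracket X Y p f = X p (fun q => Y q f) - Y p (fun q => X q f).
Proof.
move=> oW Wp sX sY sf.
apply: (to_tangentE (D := fun f => X p (fun q => Y q f) - Y p (fun q => X q f))) => //.
move=> i ip.
pose a k := 'D_(component (X p) i)
  (fun x => component (Y (cinv i x)) i 0 k) (cmap i p).
pose b k := 'D_(component (Y p) i)
  (fun x => component (X (cinv i x)) i 0 k) (cmap i p).
exists (\row_k a k - \row_k b k) => h sh.
rewrite (iterated_derivation _ oW Wp ip sY sh) (iterated_derivation _ oW Wp ip sX sh).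
have dh := msmooth_near_diff ip sh.
rewrite [in RHS]deriveE// linearB/= -!deriveE//.
have [N [oN Np] sN] := sh.
have oO := @open_chart _ _ M i _ oN.
rewrite (schwarz (component (Y p) i) (component (X p) i) oO (sN i)); last first.
  by split; [exact: cmap_ran|rewrite cmapK].
by rewrite opprD addrACA subrr add0r.
Qed.

End Bracket.

Section ProductGeometry.
Context {R : realType} {n1 n2 : nat} {M1 : manifold R n1} {M2 : manifold R n2}.
Local Notation M := (prod_manifold M1 M2).

(* The lift of X, at (p, q), is the image of X p under the differential of the
   inclusion p' |-> (p', q) of M1; similarly for lift2. *)
Definition lift1 (X : vfield M1) : vfield M := fun x =>
  to_tangent x (fun f => X x.1 (fun p => f (p, x.2))).

Definition lift2 (X : vfield M2) : vfield M := fun x =>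
  to_tangent x (fun f => X x.2 (fun q => f (x.1, q))).

Definition doubly_warped (f1 : M1 -> R) (f2 : M2 -> R) (g1 : form2 M1)
    (g2 : form2 M2) : form2 M := fun x v w =>
  f2 x.2 ^+ 2 * g1 x.1 (pushforward (fst : M -> M1) v)
                       (pushforward (fst : M -> M1) w)
  + f1 x.1 ^+ 2 * g2 x.2 (pushforward (snd : M -> M2) v)
                         (pushforward (snd : M -> M2) w).

Lemma msmooth_near_fst (x : M) (f : M1 -> R) :
  msmooth_near x.1 f -> msmooth_near x (f \o fst : M -> R).
Proof.
move=> [W [oW Wx] sf]; exists (fst @^-1` W).
  by split=> //; apply: open_comp => // y _; exact: cvg_fst.
move=> [i j] k.
rewrite (_ : _ \o _ = fun u => (f \o cinv i) (lsubmx u + 0)); last first.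
  by apply/funext => u /=; rewrite addr0.
apply: sub_Ck (Ck_precomp 0 (@lsubmx_continuous _ _ _) (sf i k)).
by move=> u [[u1 _] Wu] /=; rewrite addr0.
Qed.

Lemma msmooth_near_snd (x : M) (f : M2 -> R) :
  msmooth_near x.2 f -> msmooth_near x (f \o snd : M -> R).
Proof.
move=> [W [oW Wx] sf]; exists (snd @^-1` W).
  by split=> //; apply: open_comp => // y _; exact: cvg_snd.
move=> [i j] k.
rewrite (_ : _ \o _ = fun u => (f \o cinv j) (rsubmx u + 0)); last first.
  by apply/funext => u /=; rewrite addr0.
apply: sub_Ck (Ck_precomp 0 (@rsubmx_continuous _ _ _) (sf j k)).
by move=> u [[_ u2] Wu] /=; rewrite addr0.
Qed.

Lemma pushforward_fstE (x : M) (v : tangent M x) (f : M1 -> R) :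
  msmooth_near x.1 f -> pushforward (fst : M -> M1) v f = v (f \o fst).
Proof.
move=> sf; apply: (@to_tangentE _ _ _ _ (fun f => v (f \o fst))) => // i xi.
have [j xj] := chart_cover x.2; have [t _] := tangentP v.
have [u E] := t (i, j) (conj xi xj); exists (lsubmx u) => h sh.
rewrite (E _ (msmooth_near_fst sh)).
have -> : (h \o fst) \o @cinv _ _ M (i, j) =
    fun u => (h \o cinv i) (lsubmx u + 0).
  by apply/funext => y /=; rewrite addr0.
by rewrite derive_affine addr0 /= row_mxKl.
Qed.

Lemma pushforward_sndE (x : M) (v : tangent M x) (f : M2 -> R) :
  msmooth_near x.2 f -> pushforward (snd : M -> M2) v f = v (f \o snd).
Proof.
move=> sf; apply: (@to_tangentE _ _ _ _ (fun f => v (f \o snd))) => // j xj.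
have [i xi] := chart_cover x.1; have [t _] := tangentP v.
have [u E] := t (i, j) (conj xi xj); exists (rsubmx u) => h sh.
rewrite (E _ (msmooth_near_snd sh)).
have -> : (h \o snd) \o @cinv _ _ M (i, j) =
    fun u => (h \o cinv j) (rsubmx u + 0).
  by apply/funext => y /=; rewrite addr0.
by rewrite derive_affine addr0 /= row_mxKr.
Qed.

Lemma slice1E (f : M -> R) (i : chart M1) (j : chart M2) (q : M2) :
  cdom j q -> (fun p => f (p, q)) \o cinv i =
  fun y => (f \o @cinv _ _ M (i, j)) (rV_inl n2 y + row_mx 0 (cmap j q)).
Proof.
move=> jq; apply/funext => y /=; rewrite -rV_inlr /prod_inv /=.
by rewrite row_mxKl row_mxKr cmapK.
Qed.

Lemma slice2E (f : M -> R) (i : chart M1) (j : chart M2) (p : M1) :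
  cdom i p -> (fun q => f (p, q)) \o cinv j =
  fun y => (f \o @cinv _ _ M (i, j)) (@rV_inr _ n1 n2 y + row_mx (cmap i p) 0).
Proof.
move=> ip; apply/funext => y /=; rewrite addrC -rV_inlr /prod_inv /=.
by rewrite row_mxKl row_mxKr cmapK.
Qed.

Lemma msmooth_near_slice1 (x : M) (f : M -> R) :
  msmooth_near x f -> msmooth_near x.1 (fun p => f (p, x.2)).
Proof.
case: x => p q [W [oW Wx] sf]; exists ((fun p' : M1 => (p', q) : M) @^-1` W).
  split=> //; apply: open_comp => // y _.
  by apply: cvg_pair; [exact: cvg_id|exact: cvg_cst].
move=> i k; have [j jq] := chart_cover q; rewrite (slice1E _ _ jq).
apply: sub_Ck (Ck_precomp _ (@rV_inl_continuous _ _ _) (sf (i, j) k)).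
move=> y [yi Wy]; rewrite /mkset -rV_inlr /= /prod_inv /prod_ran /=.
by rewrite row_mxKl row_mxKr cmapK//; do 2?split=> //; exact: cmap_ran.
Qed.

Lemma msmooth_near_slice2 (x : M) (f : M -> R) :
  msmooth_near x f -> msmooth_near x.2 (fun q => f (x.1, q)).
Proof.
case: x => p q [W [oW Wx] sf]; exists ((fun q' : M2 => (p, q') : M) @^-1` W).
  split=> //; apply: open_comp => // y _.
  by apply: cvg_pair; [exact: cvg_cst|exact: cvg_id].
move=> j k; have [i ip] := chart_cover p; rewrite (slice2E _ _ ip).
apply: sub_Ck (Ck_precomp _ (@rV_inr_continuous _ _ _) (sf (i, j) k)).
move=> y [yj Wy]; rewrite /mkset addrC -rV_inlr /= /prod_inv /prod_ran /=.
by rewrite row_mxKl row_mxKr cmapK//; do 2?split=> //; exact: cmap_ran.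
Qed.

Lemma lift1E (X : vfield M1) (x : M) (f : M -> R) :
  msmooth_near x f -> lift1 X x f = X x.1 (fun p => f (p, x.2)).
Proof.
case: x => p q sf.
apply: (@to_tangentE _ _ _ _ (fun f : M -> R => X p (fun p => f (p, q)))) => //.
move=> [i j] [/= ip jq]; have [t _] := tangentP (X p).
have [u E] := t i ip; exists (rV_inl n2 u) => h sh.
by rewrite (E _ (msmooth_near_slice1 sh)) (slice1E _ _ jq) derive_affine -rV_inlr.
Qed.

Lemma lift2E (X : vfield M2) (x : M) (f : M -> R) :
  msmooth_near x f -> lift2 X x f = X x.2 (fun q => f (x.1, q)).
Proof.
case: x => p q sf.
apply: (@to_tangentE _ _ _ _ (fun f : M -> R => X q (fun q => f (p, q)))) => //.
move=> [i j] [/= ip jq]; have [t _] := tangentP (X q).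
have [u E] := t j jq; exists (@rV_inr _ n1 n2 u) => h sh.
rewrite (E _ (msmooth_near_slice2 sh)) (slice2E _ _ ip) derive_affine.
by rewrite addrC -rV_inlr.
Qed.

End ProductGeometry.

(* Main.v *)
(* The metric is g = f2^2 P1 + f1^2 P2, where P_i is the pullback of g_i along the
   projection onto M_i.  As zeta is projection-related to zeta_i, L_zeta P_i is the
   pullback of L_(zeta_i) g_i, which is 0, so
     L_zeta g = zeta(f2^2) P1 + zeta(f1^2) P2
              = 2 zeta2(ln f2) f2^2 P1 + 2 zeta1(ln f1) f1^2 P2,
   and the hypothesis makes the two coefficients equal: the conformal factor is
   2 zeta1(ln f1).  For the pullback formula, the pushforward of a field on the
   product is not a field on M_i, only a field along the projection; it is expanded
   in coordinate fields of M_i, to which the Killing equation applies. *)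
From HB Require Import structures.
Require Import Defs.
From mathcomp Require Import all_boot all_order all_algebra.
From mathcomp Require Import all_classical all_reals.
From mathcomp Require Import topology normedtype derive exp.
From mathcomp Require Import ring.
Import Order.TTheory GRing.Theory Num.Theory.
Import numFieldNormedType.Exports.
Local Open Scope classical_set_scope.
Local Open Scope ring_scope.

Set Implicit Arguments.
Unset Strict Implicit.
Unset Printing Implicit Defensive.

(** * C^k calculus: products, inverses, logarithms, compositions *)

Section CkCalculus.
Context {R : realType}.
Implicit Types V W : normedModType R.

Lemma CkW V W k (U : set V) (f : V -> W) : Ck k.+1 U f -> Ck k U f.
Proof.
elim: k f => [|k IH] f [df Df]; last by split=> // v; exact/IH/Df.
by move=> x Ux; apply: differentiable_continuous; exact: df.
Qed.

Lemma Ck_cst V W k (U : set V) (c : W) : Ck k U (fun=> c).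
Proof.
elim: k c => [|k IH] c; first by move=> x _; exact: cst_continuous.
split=> [x _|v]; first exact: differentiable_cst.
have -> : (fun x : V => 'D_v (fun=> c) x) = fun=> 0; last exact: IH.
by apply/funext => x; exact: derive_cst.
Qed.

(** By induction on [k], the Leibniz rule writes a directional derivative as a sum of products of
    C^k functions; [CkW] lowers the order of the undifferentiated factors. *)
Lemma CkM V k (U : set V) (f g : V -> R) :
  open U -> Ck k U f -> Ck k U g -> Ck k U (fun x => f x * g x).
Proof.
move=> oU; elim: k f g => [|k IH] f g.
  by move=> cf cg x Ux; apply: continuousM; [exact: cf|exact: cg].
move=> sf sg; have [df Df] := sf; have [dg Dg] := sg; split=> [x Ux|v].
  by apply: differentiableM; [exact: df|exact: dg].
apply: (eq_Ck oU _
  (CkD oU (IH _ _ (CkW sf) (Dg v)) (IH _ _ (CkW sg) (Df v)))) => x Ux /=.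
by rewrite [RHS]deriveM//; apply: diff_derivable; [exact: df|exact: dg].
Qed.

Lemma Ck_sum V k (U : set V) n (f : 'I_n -> V -> R) :
  open U -> (forall j, Ck k U (f j)) -> Ck k U (fun x => \sum_j f j x).
Proof.
move=> oU; elim: n f => [|n IH] f sf.
  by under eq_fun do rewrite big_ord0; exact: Ck_cst.
under eq_fun do rewrite big_ord_recr /=.
by apply: CkD => //; exact: IH.
Qed.

(** The derivative is minus [(f x)^-1 * (f x)^-1 * 'D_v f x], where the inverse is C^k by induction,
    so [CkM] applies. *)
Lemma CkV V k (U : set V) (f : V -> R) : open U -> (forall x, U x -> f x != 0) ->
  Ck k U f -> Ck k U (fun x => (f x)^-1).
Proof.
move=> oU f0; elim: k => [|k IH] sf.
  by move=> x Ux; apply: continuousV; [exact: f0|exact: sf].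
have [df Df] := sf; split=> [x Ux|v].
  by apply: differentiableV; [exact: df|exact: f0].
have sV := IH (CkW sf).
have sN := CkM oU (@Ck_cst V R k U (-1)) (CkM oU (CkM oU sV sV) (Df v)).
apply: (eq_Ck oU _ sN) => x Ux; rewrite [RHS]deriveV; last first.
- by apply: diff_derivable; exact: df.
- exact: f0.
by rewrite mulN1r -mulNr -expr2 exprVn.
Qed.

Lemma derive_ln V (f : V -> R) (x v : V) : 0 < f x -> differentiable f x ->
  differentiable (fun x => ln (f x)) x /\
  'D_v (fun x => ln (f x)) x = (f x)^-1 * 'D_v f x.
Proof.
move=> f0 df; have dl := is_derive1_ln f0.
have dln : differentiable (@ln R) (f x) by apply/derivable1_diffP; have [] := dl.
have dlf : differentiable (@ln R \o f) x by exact: differentiable_comp.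
split=> //; rewrite (deriveE v dlf) (diff_comp df dln) /= -(deriveE v df).
(* Writing ['D_v f x] as a multiple of 1 lets linearity of the differential bring out the derivative
   of [ln] in direction 1. *)
rewrite -[X in 'd _ _ X](mulr1 ('D_v f x)) -[_ * 1]/(_ *: 1) linearZ /=.
by rewrite -deriveE//; have [_ ->] := dl; rewrite mulrC.
Qed.

(** A single differentiation replaces the logarithm by an inverse, so order [k.+1] follows from
    [CkV] and [CkM]. *)
Lemma Ck_ln V k (U : set V) (f : V -> R) : open U -> (forall x, U x -> 0 < f x) ->
  Ck k U f -> Ck k U (fun x => ln (f x)).
Proof.
move=> oU f0; case: k => [|k] sf.
  move=> x Ux; apply: (continuous_comp (sf x Ux)).
  by apply: continuous_ln; exact: f0.
have [df Df] := sf; split=> [x Ux|v].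
  by have [] := derive_ln 0 (f0 x Ux) (df x Ux).
have sV : Ck k U (fun x => (f x)^-1).
  by apply: CkV (CkW sf) => // x Ux; rewrite gt_eqF// f0.
apply: (eq_Ck oU _ (CkM oU sV (Df v))) => x Ux.
by have [_ ->] := derive_ln v (f0 x Ux) (df x Ux).
Qed.

Lemma derive_comp_row n V (f : 'rV[R]_n -> R) (g : V -> 'rV[R]_n) (x v : V) :
  differentiable g x -> differentiable f (g x) ->
  'D_v (f \o g) x = 'D_('D_v g x) f (g x).
Proof.
move=> dg df; have dfg : differentiable (f \o g) x by exact: differentiable_comp.
by rewrite (deriveE v dfg) (diff_comp dg df) /= -!deriveE.
Qed.

Lemma derive_linear_row n n' (A : {linear 'rV[R]_n -> 'rV[R]_n'})
    (f : 'rV[R]_n' -> R) (u : 'rV[R]_n') (c : 'rV[R]_n) : differentiable f u ->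
  'D_(A c) f u = \sum_k c 0 k * 'D_(A (delta_mx 0 k)) f u.
Proof.
move=> df; rewrite deriveE// {1}(row_sum_delta c) !linear_sum.
by apply: eq_bigr => k _; rewrite !linearZ deriveE.
Qed.

Lemma Ck_coord n V k (U : set V) (g : V -> 'rV[R]_n) j :
  open U -> Ck k U g -> Ck k U (fun y => g y 0 j : R).
Proof.
move=> oU.
exact: (@Ck_postcomp _ _ _ _ k (@rV_coord R n j) U g oU (@rV_coord_continuous R n j)).
Qed.

(** [Ck] controls derivatives in fixed directions, whereas the chain rule differentiates [f] in the
    direction ['D_v g x], which moves with [x]. Expanding it in the standard basis gives a finite
    sum of products whose factors are C^k by hypothesis or by induction. *)
Lemma Ck_comp n V k (U : set V) (U' : set 'rV[R]_n) (f : 'rV[R]_n -> R)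
    (g : V -> 'rV[R]_n) : open U -> (forall x, U x -> U' (g x)) ->
  Ck k U g -> Ck k U' f -> Ck k U (f \o g).
Proof.
move=> oU gU; elim: k f => [|k IH] f sg sf.
  by move=> x Ux; apply: continuous_comp; [exact: sg|exact/sf/gU].
have [df Df] := sf; have [dg Dg] := sg; split=> [x Ux|v].
  by apply: differentiable_comp; [exact: dg|exact/df/gU].
have s j : Ck k U (fun x => ('D_v g x) 0 j * 'D_(delta_mx 0 j) f (g x)).
  apply: CkM => //; first exact: (Ck_coord _ oU (Dg v)).
  exact: (IH _ (CkW sg) (Df (delta_mx 0 j))).
apply: (eq_Ck oU _ (Ck_sum oU s)) => x Ux.
rewrite derive_comp_row; [|exact: dg|exact/df/gU].
rewrite -derive_row; last exact/df/gU.
by congr ('D_ _ _ _); apply/rowP => j; rewrite mxE.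
Qed.

(** The neighbourhood of each point serves the derivatives too, so it is kept through the induction.
    This passes from smoothness near every point to smoothness on a set. *)
Lemma Ck_local V W k (U : set V) (f : V -> W) :
  (forall x, U x -> exists2 O, open_nbhs x O & Ck k O f) -> Ck k U f.
Proof.
elim: k f => [|k IH] f lf.
  by move=> x /lf[O [_ Ox] cf]; exact: cf.
split=> [x /lf[O [_ Ox] [df _]]|v]; first exact: df.
by apply: IH => x /lf[O xO [_ /(_ v) Df]]; exists O.
Qed.

End CkCalculus.

(** * Smooth functions near a point of a manifold *)

Section SmoothFunctions.
Context {R : realType} {n : nat} {M : manifold R n}.
Implicit Types (f g : M -> R) (p : M) (W N : set M).

Lemma msmooth_on_near W p f : open W -> W p -> msmooth_on W f -> msmooth_near p f.
Proof. by move=> oW Wp sf; exists W. Qed.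

Lemma msmooth_near_on W f :
  (forall p, W p -> msmooth_near p f) -> msmooth_on W f.
Proof.
move=> sf i k; apply: Ck_local => x [ix Wx].
have [N [oN Nx] sN] := sf _ Wx.
exists [set x | cran i x /\ N (cinv i x)]; last exact: sN.
by split=> //; exact: open_chart.
Qed.

Lemma eq_msmooth_near N p f g : open N -> N p -> (forall q, N q -> f q = g q) ->
  msmooth_near p f -> msmooth_near p g.
Proof.
move=> oN Np fg [W [oW Wp] sf]; exists (N `&` W); first by split=> //; exact: openI.
move=> i k; have oO := open_chart (i := i) (openI oN oW).
apply: (eq_Ck oO _ (sub_Ck _ (sf i k))) => [x [ix [Nx _]]|x [ix [_ Wx]]] //=.
exact: fg.
Qed.

Lemma msmooth_near_cst p (c : R) : msmooth_near p (fun=> c).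
Proof.
exists setT; first by split=> //; exact: openT.
by move=> i k; exact: Ck_cst.
Qed.

Lemma msmooth_nearD p f g : msmooth_near p f -> msmooth_near p g ->
  msmooth_near p (fun q => f q + g q).
Proof.
move=> [W [oW Wp] sf] [W' [oW' W'p] sg].
exists (W `&` W'); first by split=> //; exact: openI.
move=> i k; apply: CkD; first by apply: open_chart; exact: openI.
- by apply: sub_Ck (sf i k) => x [ix []].
- by apply: sub_Ck (sg i k) => x [ix []].
Qed.

Lemma msmooth_nearM p f g : msmooth_near p f -> msmooth_near p g ->
  msmooth_near p (fun q => f q * g q).
Proof.
move=> [W [oW Wp] sf] [W' [oW' W'p] sg].
exists (W `&` W'); first by split=> //; exact: openI.
move=> i k; apply: CkM; first by apply: open_chart; exact: openI.
- by apply: sub_Ck (sf i k) => x [ix []].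
- by apply: sub_Ck (sg i k) => x [ix []].
Qed.

Lemma msmooth_near_sum m p (f : 'I_m -> M -> R) :
  (forall j, msmooth_near p (f j)) -> msmooth_near p (fun q => \sum_j f j q).
Proof.
elim: m f => [|m IH] f sf.
  by under eq_fun do rewrite big_ord0; exact: msmooth_near_cst.
under eq_fun do rewrite big_ord_recr /=.
by apply: msmooth_nearD => //; exact: IH.
Qed.

Lemma msmooth_near_ln p f : (forall q, 0 < f q) -> msmooth_near p f ->
  msmooth_near p (fun q => ln (f q)).
Proof.
move=> f0 [W [oW Wp] sf]; exists W => // i k.
apply: (Ck_ln (f := f \o cinv i) (open_chart oW) _ (sf i k)) => x _.
exact: f0.
Qed.

Lemma vfield_smooth_near W (X : vfield M) p f : open W -> W p ->
  vfield_smooth_on W X -> msmooth_near p f -> msmooth_near p (fun q => X q f).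
Proof.
move=> oW Wp sX [W' [oW' W'p] sf]; exists (W `&` W').
  by split=> //; exact: openI.
apply: sX; [exact: openI|by move=> q []|].
by apply: sub_msmooth sf => q [].
Qed.

Lemma sub_vfield_smooth W W' (X : vfield M) :
  W' `<=` W -> vfield_smooth_on W X -> vfield_smooth_on W' X.
Proof.
by move=> sW sX N f oN sN; apply: sX => //; exact: subset_trans sN sW.
Qed.

End SmoothFunctions.

(** * Derivation rules for tangent vectors *)

Section TangentCalculus.
Context {R : realType} {n : nat} {M : manifold R n} {p : M}.
Implicit Types (f g : M -> R) (v w : tangent M p).

(** If [f] is smooth near [p], both values are chart derivatives of functions that agree near the
    point; otherwise [g] is not smooth there either, and both values are 0 by the normalization in
    [is_tangent]. *)
Lemma eq_tangent (N : set M) v f g : open N -> N p ->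
  (forall q, N q -> f q = g q) -> v f = v g.
Proof.
move=> oN Np fg; have [sf|nf] := pselect (msmooth_near p f); last first.
  have [_ z] := tangentP v; rewrite !z// => sg; apply: nf.
  by apply: (eq_msmooth_near oN Np _ sg) => q Nq; rewrite fg.
have sg := eq_msmooth_near oN Np fg sf.
have [i ip] := chart_cover p; rewrite !(tangent_chartE _ ip)//.
apply: near_eq_derive; have oO := open_chart (i := i) oN.
have Ox : [set x | cran i x /\ N (cinv i x)] (cmap i p).
  by split; [exact: cmap_ran|rewrite cmapK].
near=> x; have [_ Nx] : [set x | cran i x /\ N (cinv i x)] x.
  by near: x; exact: open_nbhs_nbhs.
exact: fg.
Unshelve. all: by end_near. Qed.

Lemma tangent_addE v w f : (v + w) f = v f + w f.
Proof. by []. Qed.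

Lemma tangent_scaleE (a : R) v f : (a *: v) f = a * v f.
Proof. by []. Qed.

Lemma tangent_sumE m (v : 'I_m -> tangent M p) f :
  (\sum_j v j) f = \sum_j v j f.
Proof.
elim: m v => [|m IH] v; first by rewrite !big_ord0.
by rewrite !big_ord_recr tangent_addE IH.
Qed.

Lemma tangent_ext v w : (forall f, msmooth_near p f -> v f = w f) -> v = w.
Proof.
move=> vw; apply/val_inj/funext => f /=.
have [sf|nf] := pselect (msmooth_near p f); first exact: vw.
by have [_ ->] := tangentP v => //; have [_ ->] := tangentP w.
Qed.

Lemma tangent_cst v (c : R) : v (fun=> c) = 0.
Proof.
have [i ip] := chart_cover p.
rewrite (tangent_chartE _ ip); last exact: msmooth_near_cst.
exact: derive_cst.
Qed.

Lemma tangentD v f g : msmooth_near p f -> msmooth_near p g ->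
  v (fun q => f q + g q) = v f + v g.
Proof.
move=> sf sg; have [i ip] := chart_cover p.
have df := msmooth_near_diff ip sf; have dg := msmooth_near_diff ip sg.
rewrite !(tangent_chartE _ ip)//; last exact: msmooth_nearD.
by apply: deriveD; exact: diff_derivable.
Qed.

Lemma tangentM v f g : msmooth_near p f -> msmooth_near p g ->
  v (fun q => f q * g q) = f p * v g + g p * v f.
Proof.
move=> sf sg; have [i ip] := chart_cover p.
have df := msmooth_near_diff ip sf; have dg := msmooth_near_diff ip sg.
rewrite !(tangent_chartE _ ip)//; last exact: msmooth_nearM.
rewrite [LHS](deriveM (diff_derivable df) (diff_derivable dg)) /=.
by rewrite cmapK.
Qed.

Lemma tangent_sum m v (f : 'I_m -> M -> R) :
  (forall j, msmooth_near p (f j)) ->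
  v (fun q => \sum_j f j q) = \sum_j v (f j).
Proof.
elim: m f => [|m IH] f sf.
  by under eq_fun do rewrite big_ord0; rewrite big_ord0 tangent_cst.
under eq_fun do rewrite big_ord_recr /=.
by rewrite tangentD ?big_ord_recr ?IH//; exact: msmooth_near_sum.
Qed.

Lemma tangent_ln v f : (forall q, 0 < f q) -> msmooth_near p f ->
  v (fun q => ln (f q)) = (f p)^-1 * v f.
Proof.
move=> f0 sf; have [i ip] := chart_cover p.
have df := msmooth_near_diff ip sf.
rewrite !(tangent_chartE _ ip)//; last exact: msmooth_near_ln.
have [_ ->] := derive_ln (component v i) (f0 _) df.
by rewrite /= cmapK.
Qed.

End TangentCalculus.

(** * Coordinate vector fields of a chart *)

Section CoordinateFields.
Context {R : realType} {n : nat} {M : manifold R n}.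
Implicit Types (f : M -> R) (p : M) (i : chart M).

Definition chart_coord i k : M -> R := fun q => rV_coord k (cmap i q).

(** The partial derivative in the [k]-th coordinate of chart [i]; its values are meaningful on
    [cdom i] only. *)
Definition coord_vfield i k : vfield M := fun p =>
  to_tangent p (fun f => 'D_(delta_mx 0 k) (f \o cinv i) (cmap i p)).

Lemma msmooth_near_coord i k p : cdom i p -> msmooth_near p (chart_coord i k).
Proof.
move=> ip; apply: (msmooth_on_near (cdom_open i) ip); exact: msmooth_coord.
Qed.

Lemma coord_vfieldE i k p f : cdom i p -> msmooth_near p f ->
  coord_vfield i k p f = 'D_(delta_mx 0 k) (f \o cinv i) (cmap i p).
Proof.
move=> ip sf.
apply: (to_tangentE
  (D := fun f => 'D_(delta_mx 0 k) (f \o cinv i) (cmap i p))) => // j jp.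
have ir := cmap_ran ip.
have oO : open [set x | cran i x /\ cdom j (cinv i x)].
  exact/open_chart/cdom_open.
have Ox : [set x | cran i x /\ cdom j (cinv i x)] (cmap i p).
  by rewrite /mkset cmapK.
(* In another chart [j] the direction is the image of the [k]-th basis vector under the differential
   of the transition map, through which [h \o cinv i] factors near [cmap i p]. *)
exists ('D_(delta_mx 0 k) (cmap j \o cinv i) (cmap i p)) => h sh.
have dh : differentiable (h \o cinv j) ((cmap j \o cinv i) (cmap i p)).
  by rewrite /= cmapK//; exact: msmooth_near_diff.
have dt : differentiable (cmap j \o cinv i) (cmap i p).
  by have [+ _] := chart_transition i j 1%N; exact.
have := derive_comp_row (delta_mx 0 k) dt dh.
rewrite [in X in _ = X -> _]/= cmapK// => <-; apply: near_eq_derive; near=> x.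
have [_ jx] : [set x | cran i x /\ cdom j (cinv i x)] x.
  by near: x; exact: open_nbhs_nbhs.
by rewrite /= cmapK.
Unshelve. all: by end_near. Qed.

(** Read in a chart [j], the function is a partial derivative of [f \o cinv i] composed with the
    transition map from [j] to [i], so [Ck_comp] applies. *)
Lemma coord_vfield_smooth i k : vfield_smooth_on (cdom i) (coord_vfield i k).
Proof.
move=> W f oW sW sf j m.
(* The partial derivative costs one order, hence [m.+1]. *)
have [_ /(_ (delta_mx 0 k)) Df] := sf i m.+1.
have oU := open_chart (i := j) oW.
have st : Ck m [set x | cran j x /\ W (cinv j x)] (cmap i \o cinv j).
  by apply: sub_Ck (chart_transition j i m) => x [jx /sW].
apply: (eq_Ck oU _ (Ck_comp oU _ st Df)) => [x [jx Wx]|x [jx Wx]] /=.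
  rewrite coord_vfieldE//; first exact: sW.
  exact: (msmooth_on_near oW).
have ix := sW _ Wx; split; first exact: cmap_ran.
by rewrite cmapK.
Qed.

Lemma tangent_coordE i p (v : tangent M p) : cdom i p ->
  v = \sum_k v (chart_coord i k) *: coord_vfield i k p.
Proof.
move=> ip; apply: tangent_ext => f sf.
rewrite (tangent_chartE _ ip)// derive_row; last exact: msmooth_near_diff.
rewrite tangent_sumE; apply: eq_bigr => k _.
by rewrite tangent_scaleE coord_vfieldE.
Qed.

Lemma tangent_coord_ext i p (v w : tangent M p) : cdom i p ->
  (forall k, v (chart_coord i k) = w (chart_coord i k)) -> v = w.
Proof.
move=> ip vw; rewrite (tangent_coordE v ip) (tangent_coordE w ip).
by apply: eq_bigr => k _; rewrite vw.
Qed.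

Lemma coord_vfield_coord i k m p : cdom i p ->
  coord_vfield i k p (chart_coord i m) = (k == m)%:R.
Proof.
move=> ip; rewrite coord_vfieldE//; last exact: msmooth_near_coord.
have -> : (k == m)%:R = 'D_(delta_mx 0 k) (rV_coord m) (cmap i p) :> R.
  have rc := @rV_coord_continuous R n m.
  rewrite (deriveE _ (linear_differentiable _ rc)) (diff_lin _ rc).
  by rewrite /= /rV_coord mxE eqxx eq_sym.
apply: near_eq_derive; have ir := cmap_ran ip.
near=> x; rewrite /= /chart_coord cinvK//; near: x.
by apply: open_nbhs_nbhs; split=> //; exact: cran_open.
Unshelve. all: by end_near. Qed.

End CoordinateFields.

(** Linearity is given in the second argument; symmetry carries it to the first. *)
Lemma form2_sum (R : realType) n (M : manifold R n) (h : form2 M) (p : M) m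
    (a b : 'I_m -> R) (v w : 'I_m -> tangent M p) : pseudo_riemannian h ->
  h p (\sum_k a k *: v k) (\sum_l b l *: w l) =
  \sum_k \sum_l a k * (b l * h p (v k) (w l)).
Proof.
move=> [hl hs _ _].
have h_suml u (c : 'I_m -> R) (t : 'I_m -> tangent M p) :
    h p u (\sum_l c l *: t l) = \sum_l c l * h p u (t l).
  pose hu := GRing.isLinear.Build R _ R^o _ (h p u) (hl p u).
  pose lu : {linear tangent M p -> R^o} := HB.pack (h p u : _ -> R^o) hu.
  rewrite -[h p u]/(lu : _ -> _) linear_sum.
  by apply: eq_bigr => l _; rewrite linearZ.
rewrite hs h_suml; apply: eq_bigr => k _.
by rewrite hs h_suml mulr_sumr.
Qed.

(** * Lie derivative of a pulled-back form along a related field *)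

Section Pullback.
Context {R : realType} {m n : nat} {M : manifold R m} {N : manifold R n}.
Variables (F : M -> N) (h : form2 N) (rho : N -> R).
Arguments h : clear implicits.
Variables (Z : vfield M) (Z' : vfield N).
Hypothesis cF : continuous F.
Hypothesis sF : forall x f, msmooth_near (F x) f -> msmooth_near x (f \o F).
Hypothesis pushE : forall x (v : tangent M x) f, msmooth_near (F x) f ->
  pushforward F v f = v (f \o F).
Hypothesis hh : pseudo_riemannian h.
Hypothesis sZ : vfield_smooth_on setT Z.
Hypothesis ZZ' : forall x f, msmooth_near (F x) f -> Z x (f \o F) = Z' (F x) f.
Hypothesis hZ' : conformal_with h Z' rho.

Definition pullback : form2 M := fun x v w =>
  h (F x) (pushforward F v) (pushforward F w).

Variables (W : set M) (x : M) (i : chart N).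
Hypothesis oW : open W.
Hypothesis Wx : W x.
Hypothesis ix : cdom i (F x).

Local Notation E := (coord_vfield i).
Local Notation xi k := (chart_coord i k \o F).

Let oF : open (F @^-1` cdom i).
Proof. by apply: open_comp => [y _|]; [exact: cF|exact: cdom_open]. Qed.

Let pushforward_coordE y (v : tangent M y) : cdom i (F y) ->
  pushforward F v = \sum_k v (xi k) *: E k (F y).
Proof.
move=> iy; rewrite {1}(tangent_coordE (pushforward F v) iy).
by apply: eq_bigr => k _; rewrite pushE//; exact: msmooth_near_coord.
Qed.

Let smooth_component X k : vfield_smooth_on W X ->
  msmooth_near x (fun y => X y (xi k)).
Proof.
move=> sX; apply: (vfield_smooth_near oW Wx sX).
exact/sF/msmooth_near_coord.
Qed.

(** The pushforward of [X] is a combination of the [E k] with coefficients [X y (xi k)], and this is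
    the Leibniz rule for its bracket with [Z]. Both sides are compared on coordinate functions: [Z]
    of [X y (xi j)] gives the first sum, and [X] of [Z y (xi j)], where relatedness brings in [Z'],
    gives the second. *)
Lemma pushforward_bracket X : vfield_smooth_on W X ->
  pushforward F (bracket Z X x) =
  \sum_k Z x (fun y => X y (xi k)) *: E k (F x) +
  \sum_k X x (xi k) *: bracket Z' (E k) (F x).
Proof.
move=> sX; apply: (tangent_coord_ext ix) => j.
have sj := msmooth_near_coord j ix.
have [sZ' _ _] := hZ'.
rewrite pushE// (bracketE oW Wx (sub_vfield_smooth (@subsetT _ W) sZ) sX (sF sj)).
rewrite tangent_addE !tangent_sumE; congr (_ + _).
  rewrite (bigD1 j)// big1 => [|k kj]; rewrite tangent_scaleE.
    by rewrite coord_vfield_coord// eqxx mulr1 [RHS]addr0.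
  by rewrite coord_vfield_coord// (negbTE kj) mulr0.
have sZj := vfield_smooth_near openT I sZ' sj.
(* Relatedness gives this equality only where [F y] lies in the chart, which suffices since [X x] is
   local. *)
have -> : X x (fun y => Z y (xi j)) = X x ((fun q => Z' q (chart_coord i j)) \o F).
  apply: (eq_tangent _ oF ix) => y iy.
  by rewrite ZZ'//; exact: msmooth_near_coord.
rewrite -pushE// (pushforward_coordE _ ix) tangent_sumE -sumrN.
apply: eq_bigr => k _; rewrite !tangent_scaleE.
rewrite (bracketE (cdom_open i) ix
  (sub_vfield_smooth (@subsetT _ (cdom i)) sZ') (@coord_vfield_smooth _ _ _ i k) sj).
(* [E k] of a coordinate is constant on the chart, so [Z'] kills it and only minus [E k] of [Z'] of
   the coordinate remains in the bracket. *)
rewrite (eq_tangent _ (cdom_open i) ix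
  (fun q iq => coord_vfield_coord k j iq)) tangent_cst sub0r mulrN.
by [].
Qed.

Let pullback_coordE (X Y : vfield M) y : cdom i (F y) -> pullback (X y) (Y y) =
  \sum_k \sum_l X y (xi k) * (Y y (xi l) *
    ((fun q => h q (E k q) (E l q)) \o F) y).
Proof.
by move=> iy; rewrite /pullback !(pushforward_coordE _ iy) (form2_sum _ _ _ _ hh).
Qed.

Let smooth_form_coord k l : msmooth_near (F x) (fun q => h q (E k q) (E l q)).
Proof.
have [_ _ _ sh] := hh; apply: (msmooth_on_near (cdom_open i) ix).
by apply: sh; [exact: cdom_open|exact: coord_vfield_smooth..].
Qed.

(** Pushforwards are only fields along [F], so smoothness of [h] is applied to the coordinate fields
    and the resulting components are pulled back. *)
Lemma msmooth_near_pullback X Y : vfield_smooth_on W X -> vfield_smooth_on W Y ->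
  msmooth_near x (fun y => pullback (X y) (Y y)).
Proof.
move=> sX sY; apply: (eq_msmooth_near oF ix).
  by move=> y iy; rewrite pullback_coordE.
do 2!apply: msmooth_near_sum => ?.
apply: msmooth_nearM; first exact: smooth_component.
apply: msmooth_nearM; first exact: smooth_component.
exact/sF/smooth_form_coord.
Qed.

(** After expansion in coordinate fields, the Leibniz rule differentiates two coefficients and a
    component of [h]. The derivatives of the coefficients cancel the first sums of
    [pushforward_bracket]. The derivative of the component is one along [Z'], which the conformal
    equation for [E k] and [E l] turns into the remaining bracket terms plus [rho] times the
    component. *)
Lemma lie_form2_pullback X Y : vfield_smooth_on W X -> vfield_smooth_on W Y ->
  lie_form2 Z pullback X Y x = rho (F x) * pullback (X x) (Y x).
Proof.
move=> sX sY; rewrite /lie_form2.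
have sEE k l := sF (smooth_form_coord k l).
have sXk k := smooth_component k sX; have sYl l := smooth_component l sY.
have -> : Z x (fun y => pullback (X y) (Y y)) = \sum_k \sum_l
    (Z x (fun y => X y (xi k)) * (Y x (xi l) * h (F x) (E k (F x)) (E l (F x))) +
     X x (xi k) *
       (Z x (fun y => Y y (xi l)) * h (F x) (E k (F x)) (E l (F x)) +
        Y x (xi l) *
          (h (F x) (bracket Z' (E k) (F x)) (E l (F x)) +
           h (F x) (E k (F x)) (bracket Z' (E l) (F x)) +
           rho (F x) * h (F x) (E k (F x)) (E l (F x))))).
  rewrite (eq_tangent _ oF ix (fun y iy => pullback_coordE X Y iy)).
  rewrite tangent_sum => [|k]; last first.
    by apply: msmooth_near_sum => l; do 2?apply: msmooth_nearM.
  apply: eq_bigr => k _.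
  rewrite tangent_sum => [|l]; last by do 2?apply: msmooth_nearM.
  apply: eq_bigr => l _.
  rewrite tangentM //; last exact: msmooth_nearM.
  rewrite tangentM // (ZZ' (smooth_form_coord k l)) /=.
  have [_ _ /(_ (cdom i) (E k) (E l) (cdom_open i)
    (@coord_vfield_smooth _ _ _ i k) (@coord_vfield_smooth _ _ _ i l) _ ix)] := hZ'.
  by rewrite /lie_form2 => <-; ring.
rewrite /pullback !pushforward_bracket// !(pushforward_coordE _ ix).
have [hl hs _ _] := hh.
have hD u v w : h (F x) u (v + w) = h (F x) u v + h (F x) u w.
  by have := hl (F x) u 1 v w; rewrite !scale1r.
(* Symmetry puts the sum coming from [X] in the first slot everywhere, so that all double sums share
   the indices [k], [l] and compare termwise. *)
rewrite hD [X in _ - X - _]hs hD ![h _ _ (\sum_k X x (xi k) *: bracket _ _ _)]hs.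
rewrite ![h _ (\sum_k Y x (xi k) *: _) (\sum_k Z x _ *: _)]hs.
rewrite !(form2_sum _ _ _ _ hh) mulr_sumr -!big_split -!sumrB /=.
apply: eq_bigr => k _; rewrite mulr_sumr -!big_split -!sumrB /=.
apply: eq_bigr => l _.
ring.
Qed.

End Pullback.

(** * Smoothness and projections of lifted fields *)

Section Lifts.
Context {R : realType} {n1 n2 : nat} {M1 : manifold R n1} {M2 : manifold R n2}.
Local Notation M := (prod_manifold M1 M2).

(** In a product chart, the lift applied to [f] is the sum over [k] of the [k]-th component of [X],
    read on the first block of coordinates, times the [k]-th partial derivative of [f] in that
    block. *)
Lemma lift1_smooth (X : vfield M1) :
  vfield_smooth_on setT X -> vfield_smooth_on setT (lift1 X : vfield M).
Proof.
move=> sX W f oW _ sf [i j] m.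
have oU := open_chart (M := M) (i := (i, j)) oW.
have [df _] := sf (i, j) 1%N; have [_ Df] := sf (i, j) m.+1.
pose c k p := X p (chart_coord i k).
(* The summand 0 matches the affine form in [Ck_precomp]. *)
have sc k : Ck m [set u | @cran _ _ M (i, j) u /\ W (@cinv _ _ M (i, j) u)]
    (fun u => (c k \o cinv i) (lsubmx u + 0)).
  have sck := sX _ _ (cdom_open i) (@subsetT _ _) (@msmooth_coord _ _ _ i k) i m.
  apply: sub_Ck (Ck_precomp 0 (@lsubmx_continuous _ _ _) sck) => u [[u1 _] _] /=.
  by rewrite addr0; split=> //; exact: cinv_dom.
apply: (eq_Ck oU _ (Ck_sum oU (fun k =>
  CkM oU (sc k) (Df (rV_inl n2 (delta_mx 0 k)))))) => u Uu.
have [[/= u1 u2] Wu] := Uu.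
have sfu : msmooth_near (@cinv _ _ M (i, j) u) f by exists W.
rewrite /= lift1E// (tangent_chartE _ (cinv_dom u1)); last first.
  exact: (msmooth_near_slice1 sfu).
rewrite (slice1E _ _ (cinv_dom u2)) derive_affine !cinvK// -rV_inlr hsubmxK.
rewrite (derive_linear_row (@rV_inl R n1 n2)); last exact: df.
by apply: eq_bigr => k _; rewrite /component mxE addr0.
Qed.

Lemma lift2_smooth (X : vfield M2) :
  vfield_smooth_on setT X -> vfield_smooth_on setT (lift2 X : vfield M).
Proof.
move=> sX W f oW _ sf [i j] m.
have oU := open_chart (M := M) (i := (i, j)) oW.
have [df _] := sf (i, j) 1%N; have [_ Df] := sf (i, j) m.+1.
pose c k p := X p (chart_coord j k).
have sc k : Ck m [set u | @cran _ _ M (i, j) u /\ W (@cinv _ _ M (i, j) u)]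
    (fun u => (c k \o cinv j) (rsubmx u + 0)).
  have sck := sX _ _ (cdom_open j) (@subsetT _ _) (@msmooth_coord _ _ _ j k) j m.
  apply: sub_Ck (Ck_precomp 0 (@rsubmx_continuous _ _ _) sck) => u [[_ u2] _] /=.
  by rewrite addr0; split=> //; exact: cinv_dom.
apply: (eq_Ck oU _ (Ck_sum oU (fun k =>
  CkM oU (sc k) (Df (@rV_inr _ n1 n2 (delta_mx 0 k)))))) => u Uu.
have [[/= u1 u2] Wu] := Uu.
have sfu : msmooth_near (@cinv _ _ M (i, j) u) f by exists W.
rewrite /= lift2E// (tangent_chartE _ (cinv_dom u2)); last first.
  exact: (msmooth_near_slice2 sfu).
rewrite (slice2E _ _ (cinv_dom u1)) derive_affine !cinvK//.
rewrite (addrC (rV_inr _ _)) -rV_inlr hsubmxK.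
rewrite (derive_linear_row (@rV_inr R n1 n2)); last exact: df.
by apply: eq_bigr => k _; rewrite /component mxE addr0.
Qed.

Lemma lift_add_smooth (X : vfield M1) (Y : vfield M2) :
  vfield_smooth_on setT X -> vfield_smooth_on setT Y ->
  vfield_smooth_on setT (fun x : M => lift1 X x + lift2 Y x).
Proof.
move=> sX sY W f oW _ sf; apply: msmooth_near_on => x Wx.
have sfx := msmooth_on_near oW Wx sf.
apply: msmooth_nearD; apply: (vfield_smooth_near openT I _ sfx).
- exact: lift1_smooth.
- exact: lift2_smooth.
Qed.

(** [f \o fst] is constant along the second factor, so [lift2 Y] annihilates it. This is the
    relatedness hypothesis [ZZ'] for the first projection. *)
Lemma lift_add_fst (X : vfield M1) (Y : vfield M2) (x : M) (f : M1 -> R) :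
  msmooth_near x.1 f -> (lift1 X x + lift2 Y x) (f \o fst) = X x.1 f.
Proof.
move=> sf; have sF := msmooth_near_fst sf.
by rewrite tangent_addE lift1E// lift2E// [X in _ + X](tangent_cst _ (f x.1)) addr0.
Qed.

Lemma lift_add_snd (X : vfield M1) (Y : vfield M2) (x : M) (f : M2 -> R) :
  msmooth_near x.2 f -> (lift1 X x + lift2 Y x) (f \o snd) = Y x.2 f.
Proof.
move=> sf; have sF := msmooth_near_snd sf.
by rewrite tangent_addE lift1E// lift2E// [X in X + _](tangent_cst _ (f x.2)) add0r.
Qed.

End Lifts.

(** * The conformal equation on the doubly warped product *)

Unset Implicit Arguments.

Theorem theorem3 (R : realType) (n1 n2 : nat)
  (M1 : manifold R n1) (M2 : manifold R n2)
  (g1 : form2 M1) (g2 : form2 M2)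
  (hg1 : pseudo_riemannian g1) (hg2 : pseudo_riemannian g2)
  (f1 : M1 -> R) (f2 : M2 -> R)
  (sf1 : msmooth_on setT f1) (sf2 : msmooth_on setT f2)
  (f1_gt0 : forall p, 0 < f1 p) (f2_gt0 : forall q, 0 < f2 q)
  (zeta1 : vfield M1) (zeta2 : vfield M2)
  (szeta1 : vfield_smooth_on setT zeta1) (szeta2 : vfield_smooth_on setT zeta2)
  (kzeta1 : killing g1 zeta1) (kzeta2 : killing g2 zeta2)
  (hln : forall x : prod_manifold M1 M2,
     zeta1 x.1 (fun p => ln (f1 p)) = zeta2 x.2 (fun q => ln (f2 q))) :
  conformal (doubly_warped f1 f2 g1 g2)
    (fun x => lift1 zeta1 x + lift2 zeta2 x).
Proof.
pose Z : vfield (prod_manifold M1 M2) := fun x => lift1 zeta1 x + lift2 zeta2 x.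
have sZ : vfield_smooth_on setT Z by exact: lift_add_smooth.
have nf1 p : msmooth_near p f1 by exact: (msmooth_on_near openT).
have nf2 q : msmooth_near q f2 by exact: (msmooth_on_near openT).
pose rho (x : prod_manifold M1 M2) := 2 * zeta1 x.1 (fun p => ln (f1 p)).
exists rho; split=> //.
  (* [rho] depends on the first factor only, so its smoothness is pulled back along [fst]. *)
  apply: msmooth_near_on => x _; apply: msmooth_nearM; first exact: msmooth_near_cst.
  apply: (msmooth_near_fst (f := fun p => zeta1 p (fun p => ln (f1 p)))).
  exact/(vfield_smooth_near openT I szeta1)/msmooth_near_ln.
move=> W X Y oW sX sY x Wx.
have Zf1 : Z x (f1 \o fst) = f1 x.1 * zeta1 x.1 (fun p => ln (f1 p)).
  rewrite lift_add_fst// tangent_ln// mulVKf//; exact/lt0r_neq0/f1_gt0.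
(* Here [hln] enters: both warping functions get the same logarithmic derivative along [Z]. *)
have Zf2 : Z x (f2 \o snd) = f2 x.2 * zeta1 x.1 (fun p => ln (f1 p)).
  rewrite hln lift_add_snd// tangent_ln// mulVKf//; exact/lt0r_neq0/f2_gt0.
have [i xi] := chart_cover x.1; have [j xj] := chart_cover x.2.
have c1 : continuous (fst : prod_manifold M1 M2 -> M1) by move=> y; exact: cvg_fst.
have c2 : continuous (snd : prod_manifold M1 M2 -> M2) by move=> y; exact: cvg_snd.
(* A Killing field has factor 0, so [K1] and [K2] say that the Lie derivatives of both pullbacks
   along [Z] vanish. *)
have K1 := lie_form2_pullback c1 (@msmooth_near_fst _ _ _ M1 M2)
  (@pushforward_fstE _ _ _ M1 M2) hg1 sZ
  (fun y f => @lift_add_fst _ _ _ M1 M2 zeta1 zeta2 y f) kzeta1 oW Wx xi sX sY.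
have K2 := lie_form2_pullback c2 (@msmooth_near_snd _ _ _ M1 M2)
  (@pushforward_sndE _ _ _ M1 M2) hg2 sZ
  (fun y f => @lift_add_snd _ _ _ M1 M2 zeta1 zeta2 y f) kzeta2 oW Wx xj sX sY.
have s1 := msmooth_near_pullback c1 (@msmooth_near_fst _ _ _ M1 M2)
  (@pushforward_fstE _ _ _ M1 M2) hg1 oW Wx xi sX sY.
have s2 := msmooth_near_pullback c2 (@msmooth_near_snd _ _ _ M1 M2)
  (@pushforward_sndE _ _ _ M1 M2) hg2 oW Wx xj sX sY.
have sF1 := msmooth_near_fst (nf1 x.1); have sF2 := msmooth_near_snd (nf2 x.2).
set P1 := pullback _ _ in K1 s1; set P2 := pullback _ _ in K2 s2.
move: K1 K2; rewrite -/Z /lie_form2 !mul0r => K1 K2.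
have dwE y (v w : tangent (prod_manifold M1 M2) y) :
  doubly_warped f1 f2 g1 g2 v w = f2 y.2 ^+ 2 * P1 y v w + f1 y.1 ^+ 2 * P2 y v w by [].
(* Squares become iterated products, ready for two uses of the product rule each. *)
have -> : (fun y => doubly_warped f1 f2 g1 g2 (X y) (Y y)) =
    (fun y => (f2 \o snd) y * ((f2 \o snd) y * P1 y (X y) (Y y)) +
      (f1 \o fst) y * ((f1 \o fst) y * P2 y (X y) (Y y))).
  by apply/funext => y; rewrite dwE !expr2 -!mulrA.
rewrite tangentD; first last.
- by apply: msmooth_nearM => //; exact: msmooth_nearM.
- by apply: msmooth_nearM => //; exact: msmooth_nearM.
rewrite tangentM//; last exact: msmooth_nearM.
rewrite tangentM// Zf2.
rewrite tangentM//; last exact: msmooth_nearM.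
rewrite tangentM// Zf1 !dwE /rho -[(f1 \o fst) x]/(f1 x.1) -[(f2 \o snd) x]/(f2 x.2).
(* [K1] and [K2] trade the derivatives of [P1] and [P2] along [Z] for bracket terms, which cancel
   those in the Lie derivative of the warped metric. *)
move/eqP: K1; rewrite -addrA -opprD subr_eq0 => /eqP ->.
move/eqP: K2; rewrite -addrA -opprD subr_eq0 => /eqP ->.
ring.
Qed.
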